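(* Let $n\ge 2$, let $k$ be an algebraically closed field of characteristic $p>0$, and let $\Omega$ be a space $L_{\lambda p^{n-1},n}$ of meromorphic differential forms on $\mathbb{P}^1_k$. Then there exist polynomials $Q_1,\dots,Q_n\in k[X]$ of degree $\lambda$ such that, writing $P:=\Delta_n(Q_1,\dots,Q_n)$ and $P_i:=(-1)^{i-1}\Delta_{n-1}(\underline{\hat{Q}_i})$, we have $P_i\mid P$ for all $i$ and $\Omega=\langle\omega_1,\dots,\omega_n\rangle_{\mathbb{F}_p}$ with $\omega_i=\frac{P_i}{P}dX$.
   Context: The Moore determinant of $a_1,\dots,a_n$ (in a ring of characteristic $p$) is $\Delta_n(a_1,\dots,a_n)=\det\big(a_j^{p^{i-1}}\big)_{1\le i,j\le n}$; $\underline{\hat{Q}_i}$ denotes the tuple $(Q_1,\dots,Q_n)$ with $Q_i$ removed. A meromorphic differential form $f(X)dX$ on $\mathbb{P}^1_k$ is logarithmic if it equals $dF/F$ for some nonzero $F\in k(X)$; its order at $\infty$ is $\mathrm{ord}_0(f(1/X))-2$. For positive integers $m,n$, a space $L_{m+1,n}$ is an $n$-dimensional $\mathbb{F}_p$-vector space of meromorphic differential forms on $\mathbb{P}^1_k$ whose nonzero elements are all logarithmic and each have a unique zero, located at $\infty$, of order $m-1$. Here $\lambda$ is a positive integer. *)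

(* Defs.v *)
From HB Require Import structures.
From mathcomp Require Import all_boot all_order all_algebra.
From mathcomp Require Import ring zify.

Set Implicit Arguments.
Unset Strict Implicit.
Unset Printing Implicit Defensive.

Import Order.TTheory GRing.Theory Num.Theory.
Local Open Scope ring_scope.

(* k(X).  A meromorphic differential form f(X) dX on P^1_k is represented by
   its coefficient f : ratfun k. *)
Notation ratfun k := {fraction {poly k}}.

Notation "x %:F" := (@FracField.tofrac _ x) : ring_scope.

Lemma exprVn_div (F : fieldType) (x : F) (i m : nat) : x != 0 -> (i <= m)%N ->
  x^-1 ^+ (m - i) = x ^+ i / x ^+ m.
Proof.
move=> x0 lim; rewrite exprVn -{2}(subnK lim) exprD invfM mulrCA mulfV ?mulr1 //.
by rewrite expf_neq0.
Qed.

Section RationalFunctions.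
Variable k : fieldType.
Implicit Types (f F : ratfun k) (u v : {poly k}) (a : k).

(* A numerator and a denominator of f, not necessarily coprime; the
   definitions below do not depend on this choice, see the lemmas [_div]. *)
Definition fnum f : {poly k} := \n_(repr f).
Definition fden f : {poly k} := \d_(repr f).

Definition fderiv F : ratfun k :=
  ((fnum F)^`() * fden F - fnum F * (fden F)^`())%:F / (fden F ^+ 2)%:F.

(* f dX = dF / F *)
Definition logarithmic f : Prop := exists2 F, F != 0 & f = fderiv F / F.

(* The order of vanishing at a (a junk value when f = 0). *)
Definition ford a f : int := (mup a (fnum f))%:Z - (mup a (fden f))%:Z.

Definition eval_invX u : ratfun k := (map_poly (fun c => c%:P%:F) u).['X%:F^-1].

(* f(1/X) *)
Definition finvX f : ratfun k := eval_invX (fnum f) / eval_invX (fden f).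

(* The order of f dX at a point of P^1_k: Some a is the point X = a, where the
   local parameter is X - a, and None is the point at infinity. *)
Definition form_ord (x : option k) f : int :=
  if x is Some a then ford a f else ford 0 (finvX f) - 2.

Lemma fden_neq0 f : fden f != 0.
Proof. exact: denom_ratioP. Qed.

Lemma fnumden f : f * (fden f)%:F = (fnum f)%:F.
Proof.
rewrite /fnum /fden.
rewrite -{1}[f]reprK; move: (repr f) => r; rewrite !piE.
apply/eqP; rewrite eqmodE /= FracField.equivfE.
rewrite /FracField.mulf !numden_Ratio ?mulf_neq0 ?oner_neq0 ?denom_ratioP //.
by rewrite !mulr1 mulrC.
Qed.

Lemma fnumden_cross u v : v != 0 ->
  fnum (u%:F / v%:F) * v = u * fden (u%:F / v%:F).
Proof.
move=> v0; move def_f: (u%:F / v%:F) => f.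
have v0' : v%:F != 0 by rewrite tofrac_eq0.
apply/eqP; rewrite -tofrac_eq !tofracM; apply/eqP.
have {def_f} <- : f * v%:F = u%:F by rewrite -def_f mulfVK.
by rewrite -fnumden mulrAC.
Qed.

Lemma fderiv_div u v : v != 0 ->
  fderiv (u%:F / v%:F) = (u^`() * v - u * v^`())%:F / (v ^+ 2)%:F.
Proof.
move=> v0; have E := fnumden_cross u v0; rewrite /fderiv.
set n := fnum _ in E *; set d := fden _ in E *.
have d0 : d != 0 by exact: fden_neq0.
apply/eqP; rewrite eqr_div ?tofrac_eq0 ?expf_neq0 // -!tofracM tofrac_eq.
have := congr1 (@deriv k) E; rewrite !derivM => E'.
have -> : (n^`() * d - n * d^`()) * v ^+ 2 =
   (n^`() * v + n * v^`()) * (d * v) - (n * v) * (d * v^`() + v * d^`()).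
  by ring.
by rewrite E' E; apply/eqP; ring.
Qed.

Lemma ford_div a u v : u != 0 -> v != 0 ->
  ford a (u%:F / v%:F) = (mup a u)%:Z - (mup a v)%:Z.
Proof.
move=> u0 v0; have E := fnumden_cross u v0; rewrite /ford.
set n := fnum _ in E *; set d := fden _ in E *.
have d0 : d != 0 by exact: fden_neq0.
have n0 : n != 0.
  by apply: contra_neq (mulf_neq0 u0 d0) => nz; rewrite -E nz mul0r.
have := congr1 (mup a) E; rewrite !mupM // => /(congr1 Posz).
rewrite !PoszD => E'.
by apply/eqP; rewrite subr_eq addrAC -subr_eq opprK E'.
Qed.


Lemma eval_invXE u : u != 0 ->
  exists2 w : {poly k}, ~~ root w 0 & eval_invX u = w%:F / ('X ^+ (size u).-1)%:F.
Proof.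
move=> u0; exists (\poly_(i < size u) u`_((size u).-1 - i)).
  by rewrite rootE horner_coef0 coef_poly size_poly_gt0 u0 subn0 -lead_coefE
             lead_coef_eq0.
have X0 : 'X%:F != 0 :> ratfun k by rewrite tofrac_eq0 polyX_eq0.
rewrite /eval_invX (horner_coef_wide _ (size_poly _ _)) [in RHS]poly_def rmorph_sum /=.
rewrite mulr_suml (reindex_inj rev_ord_inj) /=; apply: eq_bigr => i _.
have lei : (i <= (size u).-1)%N by rewrite -ltnS (ltn_predK (ltn_ord i)).
have E : (size u - i.+1 = (size u).-1 - i)%N by rewrite subnS -subn1 subnAC subn1.
rewrite E coef_poly ifT; last first.
  by rewrite -E; rewrite ltn_subrL /= (leq_trans _ (ltn_ord i)).
rewrite -mul_polyC tofracM -mulrA; congr (_ * _).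
rewrite (exprVn_div X0 lei); congr (_ / _); exact/esym/tofracXn.
Qed.

Lemma form_ord_infty_div u v : u != 0 -> v != 0 ->
  form_ord None (u%:F / v%:F) = (size v)%:Z - (size u)%:Z - 2.
Proof.
move=> u0 v0; have E := fnumden_cross u v0; rewrite /form_ord /finvX.
set n := fnum _ in E *; set d := fden _ in E *.
have d0 : d != 0 by exact: fden_neq0.
have n0 : n != 0.
  by apply: contra_neq (mulf_neq0 u0 d0) => nz; rewrite -E nz mul0r.
have [wn rn ->] := eval_invXE n0; have [wd rd ->] := eval_invXE d0.
have nz w : ~~ root w 0 -> w != 0 by apply: contraNneq => ->; rewrite root0.
have Xn m : 'X^m != 0 :> {poly k} by rewrite expf_neq0 ?polyX_eq0.
rewrite invf_div mulf_div -!tofracM ford_div ?mulf_neq0 ?Xn ?nz //.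
rewrite (mupMr _ rn) (mupMl _ rd) -['X]subr0 !mup_XsubCX eqxx.
have := congr1 (fun q : {poly k} => size q) E; rewrite !size_mul //.
move: n0 d0 u0 v0; rewrite -!size_poly_gt0.
move: (size n) (size d) (size u) (size v) => a b c e; lia.
Qed.

End RationalFunctions.

(* Meaningful for K of characteristic p > 0: then c%:R * x is the action of
   c : 'F_p on x : K, cf. pprimeChar_scale. *)
Section FpSubspaces.
Variables (p : nat) (K : fieldType).

Definition Fp_comb n (c : 'I_n -> 'F_p) (w : 'I_n -> K) : K :=
  \sum_i (c i)%:R * w i.

Definition Fp_spanned_by (S : K -> Prop) n (w : 'I_n -> K) : Prop :=
  forall x, S x <-> exists c : 'I_n -> 'F_p, x = Fp_comb c w.

Definition Fp_free n (w : 'I_n -> K) : Prop :=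
  forall c : 'I_n -> 'F_p, Fp_comb c w = 0 -> forall i, c i = 0.

Definition Fp_dim (S : K -> Prop) (n : nat) : Prop :=
  exists2 w : 'I_n -> K, Fp_spanned_by S w & Fp_free w.

End FpSubspaces.

(* The spaces L_{m+1,n}. For m = 1 the order at infinity is 0, i.e. the form
   has no zero at all. *)
Definition space_L (k : fieldType) (p m n : nat) (Om : ratfun k -> Prop) : Prop :=
  Fp_dim p Om n /\
  (forall f, Om f -> f != 0 ->
     [/\ logarithmic f,
         form_ord None f = m%:Z - 1 &
         forall a : k, form_ord (Some a) f <= 0]).

(* Row indices start at 0, hence the exponent p ^ i. *)
Definition Moore_det (R : comNzRingType) (p n : nat) (a : 'I_n -> R) : R :=
  \det (\matrix_(i < n, j < n) a j ^+ (p ^ i)).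

Definition omit (T : Type) n (i : 'I_n) (a : 'I_n -> T) : 'I_n.-1 -> T :=
  fun j => a (lift i j).

(* Main.v *)
(* Let w_1, ..., w_n be an F_p-basis of Omega. Every nonzero element of Omega is
   the inverse of a polynomial of degree m + 1, and its poles are simple with
   residues in F_p. By Moore's product formula, Delta_n(w) is, up to a constant,
   the product of the elements of Omega up to F_p^*-scaling. Counting the elements
   with a pole at a given point shows that 1 / Delta_n(w) is a polynomial all of
   whose roots have multiplicity p^(n-1). Hence, up to sign, the first column
   Delta_{n-1}(w without w_j)^p / Delta_n(w) of the inverse Moore matrix of w is
   the p^(n-1)-th power of a polynomial Q_j of degree lambda. Inverting the
   duality between w and Q gives w_j = P_j / P. *)

Require Import Defs.
From HB Require Import structures.
From mathcomp Require Import all_boot all_order all_algebra.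
From mathcomp Require Import ring zify.

Set Implicit Arguments.
Unset Strict Implicit.
Unset Printing Implicit Defensive.

Import Order.TTheory GRing.Theory Num.Theory.
Local Open Scope ring_scope.

(** * Scalars from ['F_p] and Moore matrices in characteristic [p] *)

Section FpScalars.
Variables (R : comNzRingType) (p : nat).
Hypothesis pcharR : p \in [pchar R].
Implicit Types c d : 'F_p.

Let p_pr : prime p := pcharf_prime pcharR.

Lemma Fp_natrD c d : ((c + d)%R)%:R = c%:R + d%:R :> R.
Proof.
by rewrite -natrD -[in RHS](GRing.natr_mod_pchar pcharR) -[X in (_ %% X)%N](Fp_cast p_pr).
Qed.

Lemma Fp_natrM c d : ((c * d)%R)%:R = c%:R * d%:R :> R.
Proof.
by rewrite -natrM -[in RHS](GRing.natr_mod_pchar pcharR) -[X in (_ %% X)%N](Fp_cast p_pr).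
Qed.

Lemma Fp_natrN c : ((- c)%R)%:R = - (c%:R) :> R.
Proof. by apply/eqP; rewrite -addr_eq0 -Fp_natrD addNr. Qed.

Lemma Fp_natr_eq0 c : (c%:R == 0 :> R) = (c == 0).
Proof.
rewrite -(dvdn_pcharf pcharR) -val_eqE /= /dvdn modn_small //.
by rewrite -[X in (_ < X)%N](Fp_cast p_pr) ltn_ord.
Qed.

Lemma Fp_natr_nat (e : nat) : ((e%:R : 'F_p)%R)%:R = e%:R :> R.
Proof. by rewrite val_Fp_nat // GRing.natr_mod_pchar. Qed.

Lemma sum_expr_pchar (I : Type) (r : seq I) (P : pred I) (F : I -> R) s :
  (\sum_(i <- r | P i) F i) ^+ (p ^ s) = \sum_(i <- r | P i) F i ^+ (p ^ s).
Proof.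
elim: s F => [|s IHs] F.
  by rewrite expr1; apply: eq_bigr => i _; rewrite expr1.
rewrite expnSr exprM IHs -(pFrobenius_autE pcharR) rmorph_sum.
by apply: eq_bigr => i _ /=; rewrite pFrobenius_autE -exprM.
Qed.

Lemma natr_expr_pchar (e s : nat) : e%:R ^+ (p ^ s) = e%:R :> R.
Proof.
elim: s => [|s IHs]; first by rewrite expr1.
by rewrite expnSr exprM IHs -(pFrobenius_autE pcharR) pFrobenius_aut_nat.
Qed.

(** Frobenius is a ring morphism, so it commutes with determinants. *)
Lemma Moore_det_expr n (w : 'I_n -> R) s :
  Moore_det p (fun j => w j ^+ (p ^ s)) = Moore_det p w ^+ (p ^ s).
Proof.
elim: s => [|s IHs].
  by rewrite expr1 /Moore_det; congr (\det _); apply/matrixP=> i j; rewrite !mxE expr1.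
rewrite expnSr exprM -IHs -(pFrobenius_autE pcharR) -det_map_mx.
rewrite /Moore_det; congr (\det _); apply/matrixP=> i j.
by rewrite !mxE /= pFrobenius_autE -!exprM; congr (_ ^+ _); ring.
Qed.

Definition Moore_mx n (w : 'I_n -> R) : 'M[R]_n := \matrix_(i, j) w j ^+ (p ^ i).

Lemma det_Moore_mx n (w : 'I_n -> R) : \det (Moore_mx w) = Moore_det p w.
Proof. by []. Qed.

Lemma cofactor_Moore_max n (w : 'I_n.+1 -> R) j :
  cofactor (Moore_mx w) ord_max j = (-1) ^+ (n + j) * Moore_det p (omit j w).
Proof.
rewrite /cofactor; congr (_ * \det _); apply/matrixP=> i l.
by rewrite !mxE lift_max.
Qed.

(** Deleting the first row leaves the exponents p, ..., p^n, so the minor is the Frobenius image of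
    a smaller Moore determinant. *)
Lemma cofactor_Moore_0 n (w : 'I_n.+1 -> R) j :
  cofactor (Moore_mx w) ord0 j = (-1) ^+ j * Moore_det p (omit j w) ^+ p.
Proof.
have := Moore_det_expr (omit j w) 1; rewrite expn1 => <-.
rewrite /cofactor add0n.
congr (_ * \det _).
by apply/matrixP=> i l; rewrite !mxE lift0 -exprM expnS.
Qed.

(** This and the next lemma read off the entries of the two products of the Moore matrix with its
    adjugate. *)
Lemma sum_cofactor_Moore n (w : 'I_n -> R) (i s : 'I_n) :
  \sum_j cofactor (Moore_mx w) i j * w j ^+ (p ^ s) =
  if s == i then Moore_det p w else 0.
Proof.
have /matrixP /(_ s i) := mul_mx_adj (Moore_mx w).
rewrite !mxE det_Moore_mx mulrb => <-.
by apply: eq_bigr => j _; rewrite !mxE mulrC.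
Qed.

Lemma sum_cofactor_Moore_col n (w : 'I_n -> R) (j l : 'I_n) :
  \sum_i cofactor (Moore_mx w) i l * w j ^+ (p ^ i) =
  if j == l then Moore_det p w else 0.
Proof.
have /matrixP /(_ l j) := mul_adj_mx (Moore_mx w).
rewrite !mxE det_Moore_mx mulrb eq_sym => <-.
by apply: eq_bigr => i _; rewrite !mxE.
Qed.

End FpScalars.

(** * Linear combinations over ['F_p] and Moore's product formula *)

Section MooreProduct.
Variables (K : fieldType) (p : nat).
Hypothesis pcharK : p \in [pchar K].

Let p_pr : prime p := pcharf_prime pcharK.

Lemma Fp_comb_eq n (c d : 'I_n -> 'F_p) (w v : 'I_n -> K) :
  c =1 d -> w =1 v -> Fp_comb c w = Fp_comb d v.
Proof. by move=> Ec Ew; apply: eq_bigr => i _; rewrite Ec Ew. Qed.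

Lemma Fp_comb_expr n (c : 'I_n -> 'F_p) (w : 'I_n -> K) s :
  Fp_comb c w ^+ (p ^ s) = Fp_comb c (fun i => w i ^+ (p ^ s)).
Proof.
rewrite /Fp_comb sum_expr_pchar //; apply: eq_bigr => i _.
by rewrite exprMn natr_expr_pchar.
Qed.

Lemma Fp_combB n (c d : 'I_n -> 'F_p) (w : 'I_n -> K) :
  Fp_comb (fun i => c i - d i) w = Fp_comb c w - Fp_comb d w.
Proof.
rewrite /Fp_comb -sumrB; apply: eq_bigr => i _.
by rewrite Fp_natrD // Fp_natrN // mulrBl.
Qed.

(** Turns combinations of [omit j w] into combinations of [w], so that hypotheses on the span of [w]
    pass to the smaller family. *)
Definition coef_omit n (j : 'I_n) (a : 'F_p) (c : 'I_n.-1 -> 'F_p) (i : 'I_n) : 'F_p :=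
  if unlift j i is Some l then c l else a.

Lemma coef_omit_self n (j : 'I_n) a c : coef_omit j a c j = a.
Proof. by rewrite /coef_omit unlift_none. Qed.

Lemma coef_omit_lift n (j : 'I_n) a c l : coef_omit j a c (lift j l) = c l.
Proof. by rewrite /coef_omit liftK. Qed.

Lemma Fp_comb_omit n (j : 'I_n) a c (w : 'I_n -> K) :
  Fp_comb (coef_omit j a c) w = a%:R * w j + Fp_comb c (omit j w).
Proof.
case: n j c w => [[]//|n] j c w.
rewrite /Fp_comb (bigD1_ord j) //= coef_omit_self; congr (_ + _).
by apply: eq_bigr => i _; rewrite coef_omit_lift.
Qed.

Lemma Fp_comb_omit0 n (j : 'I_n) c (w : 'I_n -> K) :
  Fp_comb (coef_omit j 0 c) w = Fp_comb c (omit j w).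
Proof. by rewrite Fp_comb_omit mul0r add0r. Qed.

Lemma Fp_comb_omit1N n (j : 'I_n) c (w : 'I_n -> K) :
  Fp_comb (coef_omit j 1 (fun i => - c i)) w = w j - Fp_comb c (omit j w).
Proof.
rewrite Fp_comb_omit (Fp_natr_nat pcharK 1) mul1r /Fp_comb -sumrN.
by congr (_ + _); apply: eq_bigr => i _; rewrite Fp_natrN // mulNr.
Qed.

Lemma Fp_free_omit n (j : 'I_n) (w : 'I_n -> K) :
  Fp_free p w -> Fp_free p (omit j w).
Proof.
move=> fw c c0 i; rewrite -(coef_omit_lift j 0 c).
by apply: fw; rewrite Fp_comb_omit0.
Qed.

Lemma Fp_free_comb_neq0 n (c : 'I_n -> 'F_p) (w : 'I_n -> K) i :
  Fp_free p w -> c i != 0 -> Fp_comb c w != 0.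
Proof. by move=> fw; apply: contra_neq => /fw. Qed.

Lemma Fp_comb_inj n (c d : {ffun 'I_n -> 'F_p}) (w : 'I_n -> K) :
  Fp_free p w -> Fp_comb c w = Fp_comb d w -> c = d.
Proof.
move=> fw E; apply/ffunP => i; apply/eqP; rewrite -subr_eq0; apply/eqP.
by apply: (fw (fun i => c i - d i)); rewrite Fp_combB E subrr.
Qed.

(* Expanding along the last column gives an additive polynomial in [w ord_max]
   that vanishes on the span of the other entries. *)
Lemma Moore_det_omit_max n (w : 'I_n.+1 -> K) :
  Moore_det p (omit ord_max w) != 0 -> Fp_free p w ->
  Moore_det p w = Moore_det p (omit ord_max w) *
    \prod_(c : {ffun 'I_n -> 'F_p}) (w ord_max - Fp_comb c (omit ord_max w)).
Proof.
set x := omit _ w => Mx0 fw; have fx := @Fp_free_omit _ ord_max _ fw.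
pose cf i := cofactor (Moore_mx p w) i ord_max.
(* The value of [q] at [y] is the Moore determinant of [w] with its last entry replaced by [y]. *)
pose q : {poly K} := \sum_i cf i *: 'X^(p ^ i).
have qE y : q.[y] = \sum_i cf i * y ^+ (p ^ i).
  by rewrite horner_sum; apply: eq_bigr => i _; rewrite hornerZ hornerXn.
have qw j : q.[w j] = if j == ord_max then Moore_det p w else 0.
  by rewrite qE sum_cofactor_Moore_col.
have qc (c : 'I_n -> 'F_p) : q.[Fp_comb c x] = 0.
  have Ec i : cf i * Fp_comb c x ^+ (p ^ i) =
      \sum_j cf i * ((c j)%:R * w (lift ord_max j) ^+ (p ^ i)).
    by rewrite Fp_comb_expr mulr_sumr.
  rewrite qE (eq_bigr _ (fun i _ => Ec i)).
  rewrite exchange_big big1 //= => j _.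
  transitivity ((c j)%:R * q.[w (lift ord_max j)]).
    by rewrite qE mulr_sumr; apply: eq_bigr => i _; rewrite mulrCA.
  by rewrite qw eq_sym (negPf (neq_lift _ _)) mulr0.
have cfm : cf ord_max = Moore_det p x.
  by rewrite /cf cofactor_Moore_max addnn -mul2n exprM sqrrN !expr1n mul1r.
have p_gt1 := prime_gt1 p_pr.
have qsz : size q = (p ^ n).+1 /\ lead_coef q = Moore_det p x.
  rewrite /q big_ord_recr /= -/(cf ord_max) cfm addrC.
  set low := \sum_(i < n) _.
  have lt : (size low < size (Moore_det p x *: 'X^(p ^ n) : {poly K})%R)%N.
    rewrite size_scale // size_polyXn ltnS.
    apply: (leq_trans (size_sum _ _ _)); apply/bigmax_leqP => i _.
    by apply: (leq_trans (size_scale_leq _ _)); rewrite size_polyXn ltn_exp2l.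
  by rewrite size_polyDl // lead_coefDl // lead_coefZ lead_coefXn mulr1 size_scale //
     size_polyXn.
pose rs := [seq Fp_comb (c : {ffun 'I_n -> 'F_p}) x | c : {ffun 'I_n -> 'F_p}].
(* Freeness makes the p^n combinations pairwise distinct, and [q] has degree p^n, so they are all of
   its roots. *)
have q_prod : q = lead_coef q *: \prod_(z <- rs) ('X - z%:P).
  apply: all_roots_prod_XsubC.
  - by rewrite (proj1 qsz) size_map -cardE card_ffun card_Fp // card_ord.
  - by apply/allP => _ /mapP[c _ ->]; apply/rootP; apply: qc.
  - by rewrite uniq_rootsE map_inj_uniq ?enum_uniq // => c d; apply: Fp_comb_inj.
have := qw ord_max; rewrite eqxx q_prod => <-.
rewrite hornerZ (proj2 qsz) horner_prod big_map big_enum /=.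
by congr (_ * _); apply: eq_bigr => c _; rewrite hornerXsubC.
Qed.

End MooreProduct.

(** * Root multiplicities and N-th powers of polynomials *)

Section PolyMup.

Lemma mup_prod (F : fieldType) (I : Type) (s : seq I) (P : pred I)
    (f : I -> {poly F}) a : (forall i, f i != 0) ->
  mup a (\prod_(i <- s | P i) f i) = (\sum_(i <- s | P i) mup a (f i))%N.
Proof.
move=> f0; elim: s => [|x s IHs]; first by rewrite !big_nil mupNroot ?root1.
rewrite !big_cons; case: ifP => // _; rewrite mupM ?IHs //.
by elim/big_rec: _ => [|i q _ q0]; rewrite ?oner_neq0 ?mulf_neq0.
Qed.

Lemma mup_exp (F : fieldType) a (q : {poly F}) N : q != 0 ->
  mup a (q ^+ N) = (N * mup a q)%N.
Proof.
by move=> q0; rewrite -[N in LHS]card_ord -prodr_const mup_prod // sum_nat_const card_ord.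
Qed.

Lemma mupZ (F : fieldType) a c (q : {poly F}) : c != 0 -> mup a (c *: q) = mup a q.
Proof. by move=> c0; rewrite -mul_polyC mupMr // rootC. Qed.

Variable k : closedFieldType.
Implicit Types u v q : {poly k}.

(** Over a closed field both polynomials split, and equal multiplicities make their root lists
    permutations of each other. *)
Lemma eq_mup_scale u v : u != 0 -> v != 0 ->
  (forall a, mup a u = mup a v) -> exists2 c, c != 0 & u = c *: v.
Proof.
move=> u0 v0 E.
have [ru Eu] := closed_field_poly_normal u.
have [rv Ev] := closed_field_poly_normal v.
have lu0 : lead_coef u != 0 by rewrite lead_coef_eq0.
have lv0 : lead_coef v != 0 by rewrite lead_coef_eq0.
have ruv : perm_eq ru rv.
  apply/allP => a _ /=.
  by rewrite -!mu_prod_XsubC -(mupZ _ _ lu0) -Eu E Ev mupZ.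
exists (lead_coef u / lead_coef v); first by rewrite mulf_neq0 ?invr_eq0.
by rewrite [LHS]Eu {2}Ev scalerA mulfVK // (perm_big _ ruv).
Qed.

Lemma closed_field_exp_root N (c : k) : (0 < N)%N -> exists b, b ^+ N = c.
Proof.
move=> N0; have [b Eb] := @solve_monicpoly k N (fun i => if i == 0 then c else 0) N0.
exists b; rewrite Eb; case: N N0 {Eb} => // N _.
rewrite big_ord_recl /= mulr1 big1 ?addr0 // => i _; by rewrite mul0r.
Qed.

(** The roots of u / v, grouped by N, give an N-th power up to a constant; that constant and [c],
    later a sign, are absorbed by an N-th root in the closed field. *)
Lemma mup_dvd_exp N c u v : (0 < N)%N -> c != 0 -> u != 0 -> v != 0 ->
  (forall a, exists e, mup a u = mup a v + N * e)%N ->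
  exists q, c *: u = v * q ^+ N.
Proof.
move=> N0 c0 u0 v0 H.
pose e a := ((mup a u - mup a v) %/ N)%N.
have {H}E a : mup a u = (mup a v + N * e a)%N.
  by rewrite /e; have [b ->] := H a; rewrite addKn mulKn.
have [ru Eu] := closed_field_poly_normal u.
have lu0 : lead_coef u != 0 by rewrite lead_coef_eq0.
pose q := \prod_(z <- undup ru) ('X - z%:P) ^+ e z.
have f0 (z : k) : ('X - z%:P) ^+ e z != 0 by rewrite expf_neq0 ?polyXsubC_eq0.
have q0 : q != 0.
  by rewrite /q; elim/big_rec: _ => [|i t _ t0]; rewrite ?oner_neq0 ?mulf_neq0.
have mq a : mup a q = e a.
  rewrite mup_prod //; under eq_bigr => z _ do rewrite mup_XsubCX.
  have [aru|aru] := boolP (a \in ru).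
    rewrite (bigD1_seq a) ?mem_undup ?undup_uniq //= eqxx big1 ?addn0 // => z za.
    by rewrite (negPf za).
  (* Off the roots of [u] the exponent [e a] is 0, in agreement with [q], which is built from the
     roots of [u] only. *)
  have : mup a u = 0%N.
    by rewrite Eu mupZ // mu_prod_XsubC; apply/count_memPn.
  rewrite E => /eqP; rewrite addn_eq0 muln_eq0 => /andP[_].
  rewrite eqn0Ngt N0 /= => /eqP ->.
  rewrite big_seq big1 // => z; rewrite mem_undup => zru.
  by case: eqP => // za; rewrite -za zru in aru.
have vq0 : v * q ^+ N != 0 by rewrite mulf_neq0 ?expf_neq0.
have [a|b b0 Eb] := eq_mup_scale u0 vq0.
  by rewrite mupM ?expf_neq0 // mup_exp // mq.
have [g Eg] := closed_field_exp_root (c * b) N0.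
exists (g *: q); rewrite exprZn Eg Eb scalerA.
by rewrite scalerAr.
Qed.

End PolyMup.

(** A nonzero linear form takes every value equally often, hence p^(n-1) times. *)
Lemma sum_Fp_linear_neq p n (r : 'I_n -> 'F_p) (b : 'F_p) :
  prime p -> [exists i, r i != 0] ->
  (\sum_(c : {ffun 'I_n -> 'F_p}) (b - \sum_i c i * r i != 0)%R = p ^ n - p ^ n.-1)%N.
Proof.
move=> p_pr /existsP[i0 ri0].
pose phi (c : {ffun 'I_n -> 'F_p}) := \sum_i c i * r i.
pose N d := (\sum_(c : {ffun 'I_n -> 'F_p} | phi c == d) 1)%N.
have NE d : N d = N 0.
  (* Translation along the coordinate [i0], scaled so that the linear form grows by exactly [d]. *)
  pose h (c : {ffun 'I_n -> 'F_p}) : {ffun 'I_n -> 'F_p} :=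
    [ffun i => c i + (if i == i0 then d / r i0 else 0)].
  have h_inj : injective h.
    by move=> c c' /ffunP E; apply/ffunP => i; have := E i; rewrite !ffunE => /addIr.
  have phih c : phi (h c) = phi c + d.
    rewrite /phi.
    have -> : d = \sum_i (if i == i0 then d / r i0 else 0) * r i.
      rewrite (bigD1 i0) //= eqxx mulfVK // big1 ?addr0 // => i ii0.
      by rewrite (negPf ii0) mul0r.
    by rewrite -big_split; apply: eq_bigr => i _; rewrite ffunE mulrDl.
  rewrite /N (reindex_inj h_inj); apply: eq_bigl => c.
  by rewrite phih -subr_eq0 addrK.
have cardF : #|{ffun 'I_n -> 'F_p}| = (p ^ n)%N by rewrite card_ffun card_Fp // card_ord.
have n0 : (0 < n)%N by apply: leq_ltn_trans (ltn_ord i0).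
have N0 : N 0 = (p ^ n.-1)%N.
  apply/eqP; rewrite -(eqn_pmul2l (prime_gt0 p_pr)) -expnS prednK // -cardF.
  rewrite -sum1_card (partition_big phi predT) //= (eq_bigr (fun=> N 0)).
    by rewrite sum_nat_const card_Fp.
  by move=> d _; rewrite -(NE d).
(* Adding the number of [c] with value [b] removes the truncated subtraction and leaves a count of
   all p^n vectors. *)
apply/eqP; rewrite -(eqn_add2r (N b)) NE {2}N0 subnK; last first.
  by rewrite leq_exp2l ?prime_gt1 // leq_pred.
rewrite -(NE b) /N [X in (_ + X)%N]big_mkcond -big_split /= -cardF -sum1_card.
apply/eqP/eq_bigr => c _; rewrite /phi subr_eq0 [b == _]eq_sym.
by case: eqP.
Qed.

(** * Identities over a generic field, later applied in [ratfun k] *)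

Section FieldIdentities.
Variable L : fieldType.

(** Logarithmic derivative of [q * (T * t)] when [t] is a power of [T] and [e] is the multiplicity
    of [T]. *)
Lemma dlog_mulX_div (T t q dq e : L) : T != 0 -> t != 0 -> q != 0 ->
  (dq * (T * t) + q * (e * t)) / (q * (T * t)) = e / T + dq / q.
Proof. by move=> *; field; apply/and3P. Qed.

Lemma dlog_div (u v du dv : L) : u != 0 -> v != 0 ->
  (du * v - u * dv) / v ^+ 2 / (u / v) = du / u - dv / v.
Proof. by move=> *; field; apply/andP. Qed.

Lemma inv_eq_polar_part (S T r g h : L) : S != 0 -> T != 0 -> h != 0 ->
  S^-1 = r / T + g / h -> T * h = S * (r * h + T * g).
Proof.
move=> S0 T0 h0 E.
have -> : r * h + T * g = (r / T + g / h) * (T * h) by field; apply/andP.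
by rewrite -E mulVKf.
Qed.

Lemma mulVf_eq_div (s d e x : L) : d != 0 -> e != 0 ->
  s * d = e * x -> d^-1 * x = s * e^-1.
Proof.
move=> d0 e0 E; apply: (mulfI e0); by rewrite mulrCA -E mulrCA mulVf // mulrCA divff.
Qed.

Lemma div_eq_inv (a b c : L) : a != 0 -> b != 0 ->
  a / b = c^-1 -> b = a * c.
Proof.
by move=> a0 b0 /(congr1 GRing.inv); rewrite invf_div invrK => <-; rewrite mulrCA divff ?mulr1.
Qed.

End FieldIdentities.

(** * Residues of forms, and the Moore determinant of a basis as the inverse of a polynomial *)

Section Residues.
Variables (k : fieldType) (p : nat).
Hypothesis pchark : p \in [pchar k].
Implicit Types (a r : k) (f : ratfun k) (u v S : {poly k}).

Let p_pr : prime p := pcharf_prime pchark.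

Lemma pchar_ratfun : p \in [pchar ratfun k].
Proof.
apply: (rmorph_pchar (@FracField.tofrac {poly k} : {rmorphism _ -> _})).
exact: (rmorph_pchar (@polyC k : {rmorphism _ -> _})).
Qed.

(* [f dX] has at most a simple pole at [a], with residue [r]. *)
Definition has_residue a f r :=
  exists g h : {poly k}, ~~ root h a /\
    f = r%:P%:F / ('X - a%:P)%:F + g%:F / h%:F.

Lemma tofrac_nroot a h : ~~ root h a -> h%:F != 0 :> ratfun k.
Proof. by rewrite tofrac_eq0; apply: contraNneq => ->; rewrite root0. Qed.

Lemma has_residue0 a : has_residue a 0 0.
Proof. by exists 0, 1; split; rewrite ?root1 // !tofrac0 !mul0r addr0. Qed.

Lemma has_residueD a f1 f2 r1 r2 :
  has_residue a f1 r1 -> has_residue a f2 r2 -> has_residue a (f1 + f2) (r1 + r2).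
Proof.
move=> [g1 [h1 [h1a ->]]] [g2 [h2 [h2a ->]]].
exists (g1 * h2 + g2 * h1), (h1 * h2); split; first by rewrite rootM negb_or h1a.
rewrite polyCD !tofracD !tofracM mulrDl addrACA; congr (_ + _).
by rewrite addf_div //; [apply: tofrac_nroot h1a | apply: tofrac_nroot h2a].
Qed.

Lemma has_residueM_nat a f r (e : nat) :
  has_residue a f r -> has_residue a (e%:R * f) (e%:R * r).
Proof.
move=> fr; elim: e => [|e IHe]; first by rewrite !mul0r; apply: has_residue0.
by rewrite -natr1 mulrDl mul1r -natr1 mulrDl mul1r; apply: has_residueD.
Qed.

Lemma has_residueN a f r : has_residue a f r -> has_residue a (- f) (- r).
Proof.
move=> [g [h [ha ->]]]; exists (- g), h; split=> //.
by rewrite polyCN !tofracN !mulNr opprD.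
Qed.

Lemma has_residue_Fp_comb a n (w : 'I_n -> ratfun k) (c r : 'I_n -> 'F_p) :
  (forall i, has_residue a (w i) (r i)%:R) ->
  has_residue a (Fp_comb c w) ((\sum_i c i * r i)%R : 'F_p)%:R.
Proof.
move=> wr; rewrite /Fp_comb; elim/big_rec2: _ => [|i s f _ sf].
  exact: has_residue0.
by rewrite Fp_natrD // Fp_natrM //; apply/has_residueD/sf/has_residueM_nat.
Qed.

(** The residue of u'/u at [a] is the multiplicity of [a] as a root of [u]. *)
Lemma has_residue_dlog a u : u != 0 ->
  exists e : nat, has_residue a (u^`()%:F / u%:F) e%:R.
Proof.
move=> u0; have [e [q qa Eu]] := multiplicity_XsubC u a.
rewrite u0 /= in qa; exists e; exists q^`(), q; split=> //.
have X0 : ('X - a%:P)%:F != 0 :> ratfun k by rewrite tofrac_eq0 polyXsubC_eq0.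
have q0 := tofrac_nroot qa.
rewrite Eu derivM deriv_exp derivXsubC mul1r.
(* Without a root at [a] there is no polar term; otherwise the exponent [e.-1] of the derivative is
   a true predecessor. *)
case: e {Eu} => [|e].
  by rewrite mulr0n !mulr0 addr0 expr0 !mulr1 polyC0 tofrac0 mul0r add0r.
move: ('X - a%:P) X0 => T T0.
rewrite /= -mulr_natl polyC_natr exprS !(tofracD, tofracM, tofracXn).
by rewrite (dlog_mulX_div _ _ T0 (expf_neq0 e T0) q0).
Qed.

(** For F = u/v the residue of dF/F is a difference of two multiplicities, hence lies in the prime
    field. *)
Lemma has_residue_logarithmic a f : logarithmic f ->
  exists r : 'F_p, has_residue a f r%:R.
Proof.
move=> [F F0 ->].
have v0 := fden_neq0 F; set v := fden F in v0.
have v0' : v%:F != 0 by rewrite tofrac_eq0.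
have EF : F = (fnum F)%:F / v%:F by apply: (canRL (mulfK v0')); apply: fnumden.
set u := fnum F in EF.
have u0 : u != 0 by apply: contraNneq F0 => uz; rewrite EF uz tofrac0 mul0r.
have [e1 H1] := has_residue_dlog a u0; have [e2 H2] := has_residue_dlog a v0.
exists (e1%:R - e2%:R).
rewrite Fp_natrD // Fp_natrN // !Fp_natr_nat //.
have -> : fderiv F / F = u^`()%:F / u%:F - v^`()%:F / v%:F.
  rewrite EF fderiv_div // tofracXn tofracB !tofracM.
  have u0' : u%:F != 0 by rewrite tofrac_eq0.
  by rewrite (dlog_div _ _ u0' v0').
by apply/has_residueD/has_residueN.
Qed.

(** Clearing denominators gives (X - a) h = S (r h + (X - a) g) with h(a) nonzero. If r is nonzero,
    the last factor does not vanish at [a]; if r = 0, cancelling X - a leaves h = S g. *)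
Lemma has_residue_inv a S r : S != 0 -> has_residue a S%:F^-1 r ->
  mup a S = (r != 0).
Proof.
move=> S0 [g [h [ha E]]].
have h0 := tofrac_nroot ha.
have X0 : ('X - a%:P)%:F != 0 :> ratfun k by rewrite tofrac_eq0 polyXsubC_eq0.
have {}E : ('X - a%:P) * h = S * (r%:P * h + ('X - a%:P) * g).
  apply/eqP; rewrite -tofrac_eq !tofracM (tofracD (r%:P * h)) !tofracM; apply/eqP.
  have S0' : S%:F != 0 by rewrite tofrac_eq0.
  exact: (inv_eq_polar_part S0' X0 h0 E).
have [r0|r0] := eqVneq r 0.
  move: E; rewrite r0 mul0r add0r mulrCA => /mulfI.
  rewrite polyXsubC_eq0 => /(_ isT) E; rewrite mupNroot //.
  by apply: contra ha; rewrite E rootM => ->.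
have /(congr1 (mup a)) := E.
have := mup_XsubCX 1 a a; rewrite expr1 eqxx => mX.
rewrite (mupMl _ ha) mX mupMl; first by move=> <-.
by rewrite /root !hornerE subrr mul0r addr0 mulf_neq0.
Qed.

(** Induction on [n] through the product formula, each new factor being the inverse of a polynomial
    of degree [d]. Such a polynomial vanishes at [a], simply, exactly when the residue of its
    combination is nonzero, so multiplicities are found by counting. *)
Lemma Moore_det_eq_inv n (w : 'I_n -> ratfun k) d :
  Fp_free p w ->
  (forall c : 'I_n -> 'F_p, Fp_comb c w != 0 ->
     exists S, size S = d.+1 /\ Fp_comb c w = S%:F^-1) ->
  exists D : {poly k}, [/\ Moore_det p w = D%:F^-1,
    size D = (d * \sum_(i < n) p ^ i).+1 &
    forall a (r : 'I_n -> 'F_p), (forall i, has_residue a (w i) (r i)%:R) ->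
      mup a D = if [exists i, r i != 0] then (p ^ n.-1)%N else 0%N].
Proof.
elim: n w => [|n IHn] w fw H.
  exists 1; split; first by rewrite /Moore_det det_mx00 tofrac1 invr1.
    by rewrite size_poly1 big_ord0 muln0.
  move=> a r _; rewrite mupNroot ?root1 //.
  by case: ifP => // /existsP[[]].
pose x := omit ord_max w; have fx : Fp_free p x by apply: Fp_free_omit.
have [|D [ED sD mD]] := IHn x fx.
  move=> c; have := H (coef_omit ord_max 0 c).
  by rewrite Fp_comb_omit0.
have D0 : D != 0 by rewrite -size_poly_gt0 sD.
pose c' (c : {ffun 'I_n -> 'F_p}) := coef_omit ord_max 1 (fun i => - c i).
have c'E c : Fp_comb (c' c) w = w ord_max - Fp_comb c x.
  exact: Fp_comb_omit1N pchar_ratfun _ _ _ _.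
have c'0 c : Fp_comb (c' c) w != 0.
  by apply: (@Fp_free_comb_neq0 _ _ _ _ _ ord_max) => //; rewrite /c' coef_omit_self oner_neq0.
have [S SE] := fin_all_exists (fun c => H (c' c) (c'0 c)).
have S0 c : S c != 0 by rewrite -size_poly_gt0 (proj1 (SE c)).
exists (D * \prod_c S c); split.
- rewrite (Moore_det_omit_max pchar_ratfun) //; last first.
    by rewrite -/x ED invr_eq0 tofrac_eq0.
  rewrite -/x ED tofracM invfM; congr (_ * _).
  rewrite rmorph_prod -prodfV; apply: eq_bigr => c _.
  by rewrite -c'E (proj2 (SE c)).
- have P0 : \prod_c S c != 0 by apply/prodf_neq0.
  rewrite size_mul // size_prod // sD.
  rewrite (eq_bigr (fun=> d.+1)) => [|c _]; last by rewrite (proj1 (SE c)).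
  rewrite sum_nat_const card_ffun card_Fp // card_ord big_ord_recr /=.
  set s := (\sum_(i < n) _)%N; rewrite mulnS mulnDr; move: (p ^ n)%N => N.
  rewrite subSn ?leq_addr // addKn [(N * d)%N]mulnC; lia.
- move=> a r wr; rewrite mupM //; last by apply/prodf_neq0.
  have xr i : has_residue a (x i) (r (lift ord_max i))%:R by apply: wr.
  rewrite (mD a _ xr) mup_prod //.
  have mS c : mup a (S c) = (r ord_max - \sum_i c i * r (lift ord_max i) != 0).
    have := has_residue_Fp_comb (c' c) wr; rewrite (proj2 (SE c)).
    move=> /(has_residue_inv (S0 c)) ->; rewrite Fp_natr_eq0 //.
    rewrite (bigD1_ord ord_max) //= /c' coef_omit_self mul1r -sumrN.
    by congr (nat_of_bool (_ + _ != 0)); apply: eq_bigr => i _; rewrite coef_omit_lift mulNr.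
  rewrite (eq_bigr _ (fun c _ => mS c)).
  (* If some earlier residue is nonzero, the new factors contribute p^n - p^(n-1), which completes
     the p^(n-1) coming from [D]. *)
  case: ifP => [ex|/negbT].
    have /existsP[i ri] := ex; have n0 := leq_ltn_trans (leq0n i) (ltn_ord i).
    rewrite ifT; last by apply/existsP; exists (lift ord_max i).
    rewrite (sum_Fp_linear_neq (r ord_max) p_pr ex) subnKC //.
    by rewrite leq_exp2l ?prime_gt1 // leq_pred.
  (* Otherwise [D] contributes nothing and all p^n factors have the same residue [r ord_max]. *)
  rewrite negb_exists => /forallP r0; rewrite add0n.
  have {}r0 i : r (lift ord_max i) = 0 by apply/eqP; have := r0 i; rewrite negbK.
  under eq_bigr => c _.
    rewrite big1 ?subr0; last by move=> i _; rewrite r0 mulr0.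
    over.
  rewrite sum_nat_const card_ffun card_Fp // card_ord.
  have [rm|rm] := eqVneq (r ord_max) 0.
    rewrite muln0; case: ifP => // /existsP[i].
    by case: (unliftP ord_max i) => [l ->|->]; rewrite ?r0 ?rm eqxx.
  by rewrite muln1 ifT //; apply/existsP; exists ord_max.
Qed.

End Residues.

(** * Duality between two families through their Moore matrices *)

Lemma Moore_det_map (R R' : comNzRingType) (f : {rmorphism R -> R'}) p n (w : 'I_n -> R) :
  Moore_det p (fun j => f (w j)) = f (Moore_det p w).
Proof.
rewrite -det_map_mx; congr (\det _); apply/matrixP=> i j.
by rewrite !mxE rmorphXn.
Qed.

(* Duality between [w] and [Q]: the hypothesis says that the [Q j ^+ (p ^ n)]
   form the first column of the inverse of the Moore matrix of [w], up to sign. *)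
Lemma Moore_dual (K : fieldType) p n (w Q : 'I_n.+1 -> K) :
  p \in [pchar K] -> Moore_det p w != 0 ->
  (forall j, Moore_det p w * Q j ^+ (p ^ n) =
             (-1) ^+ n * ((-1) ^+ j * Moore_det p (omit j w) ^+ p)) ->
  Moore_det p Q != 0 /\
  forall j, w j = (-1) ^+ j * Moore_det p (omit j Q) / Moore_det p Q.
Proof.
move=> pcharK W0 EQ; pose A j := Q j ^+ (p ^ n).
have p_gt0 := prime_gt0 (pcharf_prime pcharK).
have s1 e : (-1) ^+ e * (-1) ^+ e = 1 :> K by rewrite -exprMn mulrNN mulr1 expr1n.
have SA s : (s <= n)%N ->
    \sum_j A j * w j ^+ (p ^ s) = if s == 0%N then (-1) ^+ n else 0.
  rewrite -ltnS => sn; apply: (mulfI W0).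
  have := sum_cofactor_Moore p w ord0 (Ordinal sn); rewrite -val_eqE /= => E.
  transitivity ((-1) ^+ n * if s == 0%N then Moore_det p w else 0).
    rewrite -E !mulr_sumr; apply: eq_bigr => j _.
    by rewrite cofactor_Moore_0 // mulrA EQ !mulrA.
  by case: ifP => _; rewrite ?mulr0 // mulrC.
have QA j i : (i <= n)%N -> (Q j ^+ (p ^ i)) ^+ (p ^ (n - i)) = A j.
  by move=> le_in; rewrite -exprM -expnD subnKC.
have Q0 : Moore_det p Q != 0.
  (* For u <= s the entry (u, s) is the p^u-th power of the sum [SA] at s - u, so the product is
     lower triangular with nonzero diagonal. The Moore determinant of [A] is the p^n-th power of
     that of [Q]. *)
  have: \det (Moore_mx p A *m (Moore_mx p w)^T) != 0.
    pose T := Moore_mx p A *m (Moore_mx p w)^T.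
    have TE (u s : 'I_n.+1) : (u <= s)%N ->
        T u s = (if u == s then (-1) ^+ n else 0) ^+ (p ^ u).
      move=> le_us; have le_sn : (s - u <= n)%N.
        by apply: leq_trans (leq_subr _ _) _; rewrite -ltnS.
      have := SA _ le_sn; rewrite subn_eq0 -val_eqE eqn_leq le_us /= => <-.
      rewrite sum_expr_pchar // mxE; apply: eq_bigr => j _.
      by rewrite !mxE exprMn -(exprM (w j)) -expnD subnK.
    rewrite -/T det_trig.
      apply/prodf_neq0 => i _; rewrite TE // eqxx.
      by rewrite !expf_neq0 // oppr_eq0 oner_neq0.
    apply/is_trig_mxP => i j ij; rewrite TE ?(ltnW ij) //.
    by rewrite -val_eqE ltn_eqF // expr0n expn_eq0 eqn0Ngt p_gt0.
  rewrite det_mulmx mulf_eq0 negb_or => /andP[+ _].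
  by rewrite det_Moore_mx /A Moore_det_expr //; apply: contraNneq => ->;
     rewrite expr0n expn_eq0 eqn0Ngt p_gt0.
split=> // j; apply: (canRL (mulfK Q0)).
(* Raised to the power p^(n-i), this sum becomes [SA] at n - i, which vanishes unless i = n. *)
have SQ (i : 'I_n.+1) : \sum_l Q l ^+ (p ^ i) * w l =
    if i == ord_max then (-1) ^+ n else 0.
  have le_in : (i <= n)%N by rewrite -ltnS.
  have [->|ni] := eqVneq i ord_max.
    by have := SA 0%N isT; under eq_bigr do rewrite expr1.
  have lt_in : (i < n)%N by rewrite ltn_neqAle le_in andbT.
  suff /eqP: (\sum_l Q l ^+ (p ^ i) * w l) ^+ (p ^ (n - i)) = 0.
    by rewrite expf_eq0 => /andP[_ /eqP].
  rewrite sum_expr_pchar // (eq_bigr (fun l => A l * w l ^+ (p ^ (n - i)))).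
    by rewrite SA ?leq_subr // subn_eq0 leqNgt lt_in.
  by move=> l _; rewrite exprMn QA.
rewrite mulrC.
transitivity (\sum_l (if l == j then Moore_det p Q else 0) * w l).
  rewrite (bigD1 j) //= eqxx big1 ?addr0 // => l lj.
  by rewrite (negPf lj) mul0r.
(* Cramer's rule for the linear system [SQ] in [w]: only the last row has a nonzero right-hand
   side. *)
transitivity (\sum_i cofactor (Moore_mx p Q) i j * \sum_l Q l ^+ (p ^ i) * w l).
  under eq_bigr => l _ do rewrite -sum_cofactor_Moore_col mulr_suml.
  rewrite exchange_big; apply: eq_bigr => i _; rewrite mulr_sumr.
  by apply: eq_bigr => l _; rewrite mulrA.
rewrite (bigD1 ord_max) // SQ eqxx big1 => [|i ni].
  by rewrite cofactor_Moore_max exprD /= addr0 [LHS]mulrC !mulrA s1 mul1r.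
by rewrite SQ (negPf ni) mulr0.
Qed.

(** Without finite zeros the reduced numerator is constant, and the order m - 1 at infinity then
    forces the denominator to have degree m + 1. *)
Lemma form_eq_inv (k : closedFieldType) (f : ratfun k) m : f != 0 ->
  form_ord None f = m%:Z - 1 -> (forall a, form_ord (Some a) f <= 0) ->
  exists S : {poly k}, size S = m.+2 /\ f = S%:F^-1.
Proof.
move=> f0.
have v0 := fden_neq0 f; set v := fden f in v0.
have v0' : v%:F != 0 by rewrite tofrac_eq0.
have Ef : f = (fnum f)%:F / v%:F by apply: (canRL (mulfK v0')); apply: fnumden.
set u := fnum f in Ef.
have u0 : u != 0 by apply: contraNneq f0 => uz; rewrite Ef uz tofrac0 mul0r.
(* The chosen numerator and denominator need not be coprime. *)
pose g := gcdp u v.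
have g0 : g != 0 by rewrite gcdp_eq0 negb_and u0.
have Eu : u = (u %/ g) * g by rewrite divpK // dvdp_gcdl.
have Ev : v = (v %/ g) * g by rewrite divpK // dvdp_gcdr.
have cop : coprimep (u %/ g) (v %/ g) by apply: coprimep_div_gcd; rewrite u0.
move: (u %/ g) (v %/ g) Eu Ev cop => u1 v1 Eu Ev cop.
have u10 : u1 != 0 by apply: contraNneq u0 => z; rewrite Eu z mul0r.
have v10 : v1 != 0 by apply: contraNneq v0 => z; rewrite Ev z mul0r.
have {}Ef : f = u1%:F / v1%:F.
  have g0' : g%:F != 0 :> ratfun k by rewrite tofrac_eq0.
  have v10' : v1%:F != 0 :> ratfun k by rewrite tofrac_eq0.
  by rewrite Ef Eu Ev !tofracM -mulf_div (divff g0') mulr1.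
rewrite Ef form_ord_infty_div // => Einf Hord.
have su1 : size u1 = 1%N.
  apply/eqP/negPn/negP => /closed_rootP[a ua].
  have := Hord a; rewrite /= ford_div // (mupNroot (q := v1)).
    rewrite subr0; have := XsubC_dvd a u10; rewrite -root_factor_theorem.
    by rewrite ua; case: (mup a u1).
  by rewrite /root (coprimep_root cop).
have /size_poly1P[c c0 Ec] : size u1 == 1%N by rewrite su1.
exists (c^-1 *: v1); split.
  rewrite size_scale ?invr_eq0 //; move: Einf; rewrite su1; move: (size v1) => s; clear; lia.
rewrite Ec -mul_polyC tofracM invfM; congr (_ * _).
have cV : (c^-1)%:P%:F * c%:P%:F = 1 :> ratfun k.
  by rewrite -tofracM -polyCM mulVf // tofrac1.
exact/esym/mulr1_eq.
Qed.

(** * Construction of the polynomials [Q] from a basis of [Om] *)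

Theorem theorem4p9 (k : closedFieldType) (p : nat) (n m lambda : nat)
    (Om : ratfun k -> Prop) :
  p \in [pchar k] -> (2 <= n)%N -> (0 < lambda)%N ->
  m.+1 = (lambda * p ^ n.-1)%N ->
  space_L p m n Om ->
  exists Q : 'I_n -> {poly k},
    let P := Moore_det p Q in
    let P_ := fun i : 'I_n => (-1) ^+ i * Moore_det p (omit i Q) in
    [/\ forall i, size (Q i) = lambda.+1,
        forall i, P_ i %| P &
        Fp_spanned_by p Om (fun i => (P_ i)%:F / P%:F)].
Proof.
move=> pchark n2 l0 Em [[w spanw fw] HOm].
have pcharK := pchar_ratfun pchark; have p_pr := pcharf_prime pchark.
case: n n2 Em w spanw fw => [//|n]; rewrite ltnS /= => n0 Em w spanw fw.
have N0 : (0 < p ^ n)%N by rewrite expn_gt0 prime_gt0.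
have Omc (c : 'I_n.+1 -> 'F_p) : Om (Fp_comb c w) by apply/spanw; exists c.
have invc (c : 'I_n.+1 -> 'F_p) : Fp_comb c w != 0 ->
    exists S : {poly k}, size S = m.+2 /\ Fp_comb c w = S%:F^-1.
  by move=> c0; have [_] := HOm _ (Omc c) c0; apply: form_eq_inv.
have comb_delta i : exists2 c, Fp_comb c w = w i & exists j, c j != 0 :> 'F_p.
  (* The [- 0] matches the shape of the coefficients in [Fp_comb_omit1N]. *)
  exists (coef_omit i 1 (fun=> - 0)).
    rewrite (Fp_comb_omit1N pcharK) [X in _ - X](_ : _ = 0) ?subr0 //.
    by rewrite /Fp_comb big1 // => j _; rewrite mul0r.
  by exists i; rewrite coef_omit_self oner_neq0.
have wi i : w i != 0 /\ Om (w i).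
  have [c <- [j cj]] := comb_delta i; split=> //.
  exact: Fp_free_comb_neq0 fw cj.
have res a : exists r : 'I_n.+1 -> 'F_p, forall i, has_residue a (w i) (r i)%:R.
  apply: (fin_all_exists (P := fun i (r : 'F_p) => has_residue a (w i) r%:R)) => i.
  have [w0 Omw] := wi i; have [logw _ _] := HOm _ Omw w0.
  exact: has_residue_logarithmic.
have [D [ED sD mD]] := Moore_det_eq_inv pchark fw invc.
have D0 : D != 0 by rewrite -size_poly_gt0 sD.
(* With 1/D and 1/E the Moore determinants of [w] and [omit j w], the equation reads D = E^p Q^(p^n)
   up to sign. *)
have Qex (j : 'I_n.+1) : exists Q : {poly k}, size Q = lambda.+1 /\
    Moore_det p w * Q%:F ^+ (p ^ n) =
    (-1) ^+ n * ((-1) ^+ j * Moore_det p (omit j w) ^+ p).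
  have fwj : Fp_free p (omit j w) by apply: Fp_free_omit.
  have [c|E [EE sE mE]] := Moore_det_eq_inv (d := m.+1) pchark fwj.
    by have := invc (coef_omit j 0 c); rewrite Fp_comb_omit0.
  have E0 : E != 0 by rewrite -size_poly_gt0 sE.
  have sgn0 : (-1) ^+ n * (-1) ^+ j != 0 :> k by rewrite mulf_neq0 ?signr_eq0.
  have Ep0 : E ^+ p != 0 by rewrite expf_neq0.
  have [a|q Eq] := mup_dvd_exp N0 sgn0 D0 Ep0.
    have [r wr] := res a.
    have wjr i : has_residue a (omit j w i) (r (lift j i))%:R by apply: wr.
    rewrite (mD a r wr) mup_exp // (mE a _ wjr).
    (* If some residue other than the [j]-th is nonzero, D and E^p both have multiplicity p^n at
       [a]. Otherwise E does not vanish there and D has multiplicity 0 or p^n. *)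
    have [ex|nex] := boolP [exists i, r (lift j i) != 0]; last first.
      by exists [exists i, r i != 0]; rewrite muln0 add0n; case: ifP; rewrite ?muln1 ?muln0.
    have /existsP[i ri] := ex.
    exists 0%N; rewrite ifT; last by apply/existsP; exists (lift j i).
    by rewrite muln0 addn0 -expnS prednK.
  have q0 : q != 0.
    apply/eqP => qz; move/eqP: Eq; rewrite qz expr0n eqn0Ngt N0 mulr0 scaler_eq0.
    by rewrite (negPf sgn0) (negPf D0).
  exists q; split.
    (* Comparing degrees, (m+1)(1 + p + ... + p^n) minus (m+1)(p + ... + p^n) is m+1, that is lambda
       p^n, so [q] has degree lambda. *)
    have := congr1 (fun t : {poly k} => (size t).-1) Eq.
    rewrite size_scale // size_mul ?expf_neq0 // sD big_ord_recl /=.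
    have := size_exp E p; have := size_exp q (p ^ n); rewrite sE /=.
    have : (0 < size (E ^+ p)%R)%N by rewrite size_poly_gt0.
    have : (0 < size (q ^+ (p ^ n))%R)%N by rewrite size_poly_gt0 expf_neq0.
    have : (0 < size q)%N by rewrite size_poly_gt0.
    have -> : (\sum_(i < n) p ^ bump 0 i = p * \sum_(i < n) p ^ i)%N.
      by rewrite big_distrr; apply: eq_bigr => i _; rewrite /bump add1n expnS.
    rewrite Em; move: (size q) (size (E ^+ p)%R) (size (q ^+ (p ^ n))%R) => x y z.
    move: (\sum_(i < n) _)%N => t.
    move: (p ^ n)%N N0 => N N0; case: x => // x; case: y => // y; case: z => // z _ _ _ /=.
    move=> -> Ey; rewrite addSn /= Ey => Ex.
    congr _.+1; apply/eqP; rewrite -(eqn_pmul2r N0); apply/eqP; lia.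
  rewrite ED EE exprVn mulrA; apply: mulVf_eq_div; rewrite ?tofrac_eq0 // -tofracXn ?tofrac_eq0 //.
  have := congr1 (@FracField.tofrac _) Eq; rewrite -mul_polyC !tofracM !tofracXn => <-.
  by rewrite polyCM !polyC_exp polyCN polyC1 tofracM !tofracXn tofracN tofrac1.
have [Q EQ] := fin_all_exists Qex.
have W0 : Moore_det p w != 0 by rewrite ED invr_eq0 tofrac_eq0.
have [P0 EP] := Moore_dual pcharK W0 (fun j => proj2 (EQ j)).
pose P := Moore_det p Q; pose P_ (i : 'I_n.+1) := (-1) ^+ i * Moore_det p (omit i Q).
have PE : Moore_det p (fun j => (Q j)%:F) = P%:F.
  exact: (Moore_det_map (@FracField.tofrac _)).
have P_E i : w i = (P_ i)%:F / P%:F.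
  rewrite EP PE /P_ tofracM tofracXn tofracN tofrac1.
  by congr (_ * _ / _); apply: (Moore_det_map (@FracField.tofrac _)).
exists Q; split.
- by move=> i; have [] := EQ i.
(* The form P_i / P is also the inverse of a polynomial S, whence P = P_i S. *)
- move=> i; rewrite -/P -/(P_ i); have [c Ec [j cj]] := comb_delta i.
  have [|S [_ ES]] := invc c; first exact: Fp_free_comb_neq0 fw cj.
  have [w0 _] := wi i; rewrite PE in P0.
  have Pi0 : (P_ i)%:F != 0.
    by apply: contraNneq w0 => Pi0; rewrite P_E Pi0 mul0r.
  rewrite Ec P_E in ES.
  have /eqP := div_eq_inv Pi0 P0 ES.
  by rewrite -tofracM tofrac_eq => /eqP ->; apply: dvdp_mulr.
- by move=> f; rewrite spanw; split=> -[c ->]; exists c; apply: Fp_comb_eq.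
Qed.
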